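(* Let $p>3$ be a prime. Then $$\sum_{k=0}^{p-1}\frac{\binom{4k}{2k+1}\binom{2k}{k}}{48^k}\equiv 0\pmod{p^2}.$$
   Context: Congruences modulo $p^2$ between rational numbers whose denominators are prime to $p$ are understood in the ring $\mathbb{Z}_p$ of $p$-adic integers (equivalently, in the localization $\mathbb{Z}_{(p)}$). The binomial coefficient $\binom{n}{m}$ is $0$ when $m>n\ge 0$ (so the $k=0$ term is $0$). *)

(* Defs.v *)
From mathcomp Require Import all_boot all_order all_algebra.

Set Implicit Arguments.
Unset Strict Implicit.
Unset Printing Implicit Defensive.

Import Order.TTheory GRing.Theory Num.Theory.
Local Open Scope ring_scope.

(* The localization Z_(p), as a set of rationals (meant for p prime). *)
Definition Zloc (p : nat) : {pred rat} := [pred x : rat | coprime p `|denq x|%N].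

(* x = y (mod m) in the ring Z_(p), i.e. modulo the ideal m Z_(p). *)
Definition eqmod_Zloc (p m : nat) (x y : rat) : Prop :=
  [/\ x \in Zloc p, y \in Zloc p &
      exists2 z : rat, z \in Zloc p & x - y = m%:R * z].

(* Main.v *)
Require Import Defs.
From mathcomp Require Import all_boot all_order all_algebra.
From mathcomp Require Import zify ring.

Import Order.TTheory GRing.Theory Num.Theory.
Local Open Scope ring_scope.

(* Write N = (p - 1) / 2.  The k-th summand is f_k(-1/2) (-1/3)^k, where
   f_k(z) = C(z, k) C(2k + z, k - 1).  For k < p the polynomial f_k has
   p-integral coefficients, and -1/2 = N - p/2, so that
   2 f_k(-1/2) = 3 f_k(N) - f_k(N + p) modulo p^2.
   For M = N or N + p, the sum of f_k(M) (-3)^(M-k) over all k >= 1 is the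
   coefficient of x^(M-1) in (1 + x^3)^M, because
   (1 + x) ((1 + x)^2 - 3 x) = 1 + x^3: it is 0 for M = N, and C(N + p, N)
   for M = N + p.  In the latter case the terms with k >= p, which are not part
   of the sum, must therefore contribute C(N + p, N) modulo p^2.  They form the
   coefficient of x^(3N) in (1 + x)^(3p) V, with V a truncated binomial
   expansion of (a + b)^(N+p), a = - 3 x (1 + x), b = (1 + x)^3.  Comparing the
   coefficients of x^(N-1) and x^(3N) through (1 + x)^p = 1 + x^p + p q
   reduces the claim, by Vandermonde, to the congruences modulo p^2
   3 C(p, 3m) = C(p, m) for 0 < 3m < p and -3 C(p, 3m-p) = C(p, m) for
   p < 3m < 2p. *)

(** * Truncated binomial sums and coefficients of powers of 1 + x^3 *)

(** By Pascal's rule both sides satisfy S(N+1) = (a + b) S(N) + C(q+N+1, N+1) a^(N+1). The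
    right-hand form is the useful one when q + 1 = p: its coefficients with i > 0 are then divisible
    by p in the range needed. *)
Lemma sum_bin_trunc (R : comNzRingType) (q N : nat) (a b : R) :
  \sum_(i < N.+1) 'C(N + q.+1, i)%:R * a ^+ i * b ^+ (N - i) =
  \sum_(i < N.+1) 'C(q + i, i)%:R * a ^+ i * (a + b) ^+ (N - i).
Proof.
elim: N => [|N IHN]; first by rewrite !big_ord1 !bin0.
set S := \sum_(i < N.+1) _ in IHN.
have Sb : \sum_(i < N.+2) 'C(N + q.+1, i)%:R * a ^+ i * b ^+ (N.+1 - i) =
    b * S + 'C(q + N.+1, N.+1)%:R * a ^+ N.+1.
  rewrite [LHS]big_ord_recr /= subnn mulr1 -addSnnS [(q + _)%N]addnC mulr_sumr.
  congr (_ + _); apply: eq_bigr => i _.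
  by rewrite subSn -1?ltnS // exprS addSnnS; ring.
rewrite [RHS]big_ord_recr /= subnn mulr1.
have -> : \sum_(i < N.+1) 'C(q + i, i)%:R * a ^+ i * (a + b) ^+ (N.+1 - i) =
    (a + b) * S.
  rewrite IHN mulr_sumr; apply: eq_bigr => i _.
  by rewrite subSn -1?ltnS // exprS; ring.
rewrite mulrDl -addrA -Sb big_ord_recl [in RHS]big_ord_recl !bin0 addrCA.
congr (_ + _); rewrite mulr_sumr -big_split; apply: eq_bigr => i _ /=.
by rewrite /bump add1n subSS addSn binS natrD exprS; ring.
Qed.

Lemma coef_exp1X (R : comNzRingType) (n i : nat) :
  ((1 + 'X) ^+ n : {poly R})`_i = 'C(n, i)%:R.
Proof.
elim: n i => [|n IHn] [|i]; rewrite ?expr0 ?coef1 ?bin0 //=.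
  by rewrite exprSr mulrDr mulr1 coefD coefMX /= addr0 IHn bin0.
by rewrite exprSr mulrDr mulr1 coefD coefMX /= !IHn binS natrD.
Qed.

Lemma coefM_exp1X3 (R : comNzRingType) (q : {poly R}) (N n : nat) :
  (q * (1 + 'X^3) ^+ N)`_n =
  \sum_(l < N.+1) 'C(N, l)%:R * (if (n < 3 * l)%N then 0 else q`_(n - 3 * l)).
Proof.
rewrite exprDn mulr_sumr coef_sum; apply: eq_bigr => l _.
by rewrite expr1n mul1r mulrnAr coefMn -exprM coefMXn mulr_natl.
Qed.

Lemma coef_exp1X3 (R : comNzRingType) (N n : nat) :
  ((1 + 'X^3) ^+ N : {poly R})`_n =
  if (3 %| n)%N then 'C(N, n %/ 3)%:R else 0.
Proof.
rewrite -[_ ^+ N]mul1r coefM_exp1X3.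
case: ifP => [/dvdnP[m ->]|ndvd].
  rewrite mulnK //; case: (ltnP m N.+1) => [ltmN|leNm].
    rewrite (bigD1 (Ordinal ltmN)) //= mulnC ltnn subnn coef1 mulr1 big1 ?addr0 //.
    move=> l; rewrite -val_eqE /= => neq; case: ifP; rewrite ?mulr0 // coef1 => h.
    by rewrite (_ : (_ == _) = false) ?mulr0 //; lia.
  rewrite bin_small // big1 // => l _; case: ifP; rewrite ?mulr0 // coef1 => h.
  by rewrite (_ : (_ == _) = false) ?mulr0 //; have := ltn_ord l; lia.
rewrite big1 // => l _; case: ifP; rewrite ?mulr0 // coef1 => h.
by rewrite (_ : (_ == _) = false) ?mulr0 //; move: ndvd h; lia.
Qed.

(** * Products and binomial coefficients modulo p^2 *)

Lemma ffact_natr (R : comNzRingType) (n k : nat) :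
  (n ^_ k)%:R = \prod_(j < k) (n%:R - j%:R) :> R.
Proof.
elim: k => [|k IHk]; first by rewrite big_ord0 ffactn0.
rewrite big_ord_recr /= -IHk ffactnSr natrM.
case: (leqP k n) => [lekn|ltnk]; first by rewrite natrB.
by rewrite ffact_small // !mul0r.
Qed.

(** First-order Taylor expansion with e^2 = 0. What matters is that the derivative D is the same for
    all t. *)
Lemma prod_shift (R : comNzRingType) (e : R) (s : seq R) : e * e = 0 ->
  exists D, forall t, \prod_(u <- s) (u + e * t) = \prod_(u <- s) u + e * t * D.
Proof.
move=> ee0; elim: s => [|u s [D IHs]].
  by exists 0 => t; rewrite !big_nil mulr0 addr0.
exists (\prod_(v <- s) v + u * D) => t; rewrite !big_cons IHs.
rewrite [LHS](_ : _ = u * \prod_(v <- s) v + e * t * (\prod_(v <- s) v + u * D)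
  + e * e * (t * t * D)); last by ring.
by rewrite ee0 mul0r addr0.
Qed.

(** The hypothesis [p%:R * p%:R = 0] expresses calculation modulo p^2. Since C(p-1, j) + C(p-1, j+1)
    = C(p, j+1) is a multiple of p, multiplying by p makes these coefficients alternate in sign. *)
Lemma bin_prime_alt (R : comNzRingType) (p j : nat) :
  prime p -> p%:R * p%:R = 0 :> R -> (j < p)%N ->
  p%:R * 'C(p.-1, j)%:R = p%:R * (-1) ^+ j :> R.
Proof.
move=> p_pr pp0; elim: j => [|j IHj] ltjp; first by rewrite bin0.
have /dvdnP[c Ec]: (p %| 'C(p, j.+1))%N by rewrite prime_dvd_bin.
have := congr1 (fun n => p%:R * n%:R : R) (binS p.-1 j).
rewrite prednK ?prime_gt0 // Ec natrM mulrCA pp0 mulr0 natrD mulrDr IHj 1?ltnW //.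
by move/eqP; rewrite eq_sym addr_eq0 => /eqP->; rewrite exprS mulN1r mulrN.
Qed.

Lemma natr_bin_prime (R : comNzRingType) (p j : nat) :
  prime p -> p%:R * p%:R = 0 :> R -> (0 < j < p)%N ->
  j%:R * 'C(p, j)%:R = p%:R * (-1) ^+ j.-1 :> R.
Proof.
move=> p_pr pp0 /andP[]; case: j => // j _ ltjp.
by rewrite -natrM -mul_bin_diag natrM bin_prime_alt // ltnW.
Qed.

(** * The complete sum over k as a coefficient *)

Lemma coef_monomM_exp1X (R : comNzRingType) (c : R) (d m n : nat) :
  ((c%:P * 'X) ^+ d * (1 + 'X) ^+ m)`_n =
  if (n < d)%N then 0 else c ^+ d * 'C(m, n - d)%:R.
Proof.
by rewrite exprMn -polyC_exp mulrAC coefMXn coefCM coef_exp1X.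
Qed.

Lemma sum_bin_shift (R : comNzRingType) (M : nat) : (0 < M)%N ->
  \sum_(1 <= k < M.+1)
     'C(M, k)%:R * 'C(2 * k + M, k.-1)%:R * (-3%:R) ^+ (M - k) =
  ((1 + 'X^3) ^+ M : {poly R})`_M.-1.
Proof.
move=> M_gt0.
have -> : 1 + 'X^3 = (1 + 'X) * ((- 3%:R)%:P * 'X + (1 + 'X) ^+ 2) :> {poly R}.
  by rewrite polyCN polyC_natr; ring.
rewrite exprMn [X in _ * X]exprDn mulr_sumr coef_sum [RHS]big_ord_recl subn0 expr0.
(* The term k = 0 is (1 + x)^M (-3x)^M, which starts only at x^M. *)
rewrite bin0 mulr1 mulr1n [X in _ = X + _](_ : _ = 0) ?add0r; last first.
  by rewrite mulrC coef_monomM_exp1X prednK // leqnn.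
rewrite big_add1 /= big_mkord; apply: eq_bigr => k _; rewrite /bump add1n.
rewrite [in RHS]mulrnAr coefMn mulrCA -exprM -exprD coef_monomM_exp1X.
have ltkM := ltn_ord k; rewrite ifF; last by lia.
rewrite (_ : (M.-1 - (M - k.+1) = k)%N); last by lia.
by rewrite -[RHS]mulr_natl [(M + _)%N]addnC; ring.
Qed.

(** * The terms with k >= p *)

Lemma exp1X_prime (R : comNzRingType) (p : nat) : prime p ->
  exists q : {poly R}, (1 + 'X) ^+ p = 1 + 'X^p + p%:R * q.
Proof.
move=> p_pr; exists (\poly_(i < p) (if i == 0 then 0 else ('C(p, i) %/ p)%:R)).
apply/polyP => i; rewrite !coefD coef_exp1X coef1 coefXn mulr_natl coefMn coef_poly.
have p_gt0 := prime_gt0 p_pr.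
have [-> | i_neq0] := eqVneq i 0%N.
  by rewrite bin0 p_gt0 mul0rn (ltn_eqF p_gt0) !addr0.
case: (ltngtP i p) => [ltip | gtip | ->]; rewrite ?add0r.
- by rewrite -mulrnA divnK // prime_dvd_bin // lt0n i_neq0.
- by rewrite bin_small // mul0rn.
- by rewrite binn mul0rn addr0.
Qed.

Lemma sign_add_double (R : comNzRingType) (m n : nat) :
  (-1) ^+ (m + n.*2) = (-1) ^+ m :> R.
Proof. by rewrite -signr_odd oddD odd_double addbF signr_odd. Qed.

(** Multiply by m and apply j C(p, j) = p (-1)^(j-1) on both sides; the exponents m-1 and 3m-1 have
    equal parity. When 3m > p, set j = 3m - p: the extra p C(p, j) vanishes modulo p^2, and the odd
    shift by p flips the sign. *)
Lemma three_bin_prime (R : comUnitRingType) (p N m : nat) :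
  prime p -> (3 < p)%N -> p = N.*2.+1 -> p%:R * p%:R = 0 :> R ->
  (forall j, (0 < j < p)%N -> j%:R \is a @GRing.unit R) -> (0 < m <= N)%N ->
  'C(p, m)%:R = 3%:R * (if (3 * m < p)%N then 'C(p, 3 * m)%:R
                        else - 'C(p, 3 * m - p)%:R) :> R.
Proof.
move=> p_pr p_gt3 pE pp0 unitR /andP[m_gt0 lemN].
have um : m%:R \is a @GRing.unit R by apply: unitR; lia.
apply: (mulrI um); rewrite natr_bin_prime //; last by lia.
have ndvd3p : ~~ (3 %| p)%N by rewrite dvdn_prime2 // ltn_eqF.
rewrite mulrA -natrM [(m * 3)%N]mulnC.
case: ltnP => [lt3mp | le3mp].
  rewrite natr_bin_prime //; last by lia.
  by rewrite (_ : (3 * m).-1 = (m.-1 + m.*2)%N) ?sign_add_double //; lia.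
set j := (3 * m - p)%N.
have j_bnd : (0 < j < p)%N by rewrite /j; lia.
have /dvdnP[c Ec] : (p %| 'C(p, j))%N by rewrite prime_dvd_bin.
rewrite -[(3 * m)%N](subnK le3mp) -/j natrD mulrN mulrDl natr_bin_prime //.
rewrite Ec natrM mulrCA pp0 mulr0 addr0 -(sign_add_double _ j.-1 N.+1).
have -> : (j.-1 + N.+1.*2 = m.-1.+1 + m.*2)%N by rewrite /j; lia.
by rewrite sign_add_double exprS mulN1r mulrN opprK.
Qed.

(** The index is i = N + p - k, so that k - 1 = 3N - i because p = 2N + 1. *)
Lemma sum_bin_tail (R : comUnitRingType) (p N : nat) :
  prime p -> (3 < p)%N -> p = N.*2.+1 -> p%:R * p%:R = 0 :> R ->
  (forall j, (0 < j < p)%N -> j%:R \is a @GRing.unit R) ->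
  \sum_(i < N.+1)
    'C(N + p, i)%:R * (-3%:R) ^+ i * 'C(3 * p + 3 * N - i.*2, 3 * N - i)%:R =
  'C(N + p, N)%:R :> R.
Proof.
move=> p_pr p_gt3 pE pp0 unitR.
have ndvd3p : ~~ (3 %| p)%N by rewrite dvdn_prime2 // ltn_eqF.
pose a : {poly R} := (-3%:R)%:P * 'X * (1 + 'X).
pose b : {poly R} := (1 + 'X) ^+ 3.
have abE : a + b = 1 + 'X^3 by rewrite /a /b polyCN polyC_natr; ring.
have abX i n : a ^+ i * b ^+ n = ((-3%:R)%:P * 'X) ^+ i * (1 + 'X) ^+ (i + 3 * n).
  by rewrite /a /b exprMn -exprM exprD mulrA.
have natabX (c : nat) i n : c%:R * a ^+ i * b ^+ n =
    (((-3%:R)%:P * 'X) ^+ i * (1 + 'X) ^+ (i + 3 * n)) *+ c.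
  by rewrite -mulrA abX mulr_natl.
(* Adding the omitted terms i > N would turn b ^+ p * V into (a + b) ^+ (N + p);
   they are divisible by 'X^N.+1. *)
pose V := \sum_(i < N.+1) 'C(N + p, i)%:R * a ^+ i * b ^+ (N - i).
pose K : {poly R} := (1 + 'X^3) ^+ N.
have ppP0 : p%:R * p%:R = 0 :> {poly R} by rewrite -!polyC_natr -polyCM pp0.
have [q qE] := exp1X_prime R p p_pr.
have VE : V = \sum_(i < N.+1) 'C(p.-1 + i, i)%:R * a ^+ i * (1 + 'X^3) ^+ (N - i).
  by rewrite -abE -sum_bin_trunc prednK ?prime_gt0.
(* For 0 < i <= N, p divides C(p-1+i, i), as i C(p-1+i, i) = p C(p-1+i, i-1); only i = 0 survives
   multiplication by p. *)
have pV : p%:R * V = p%:R * K.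
  rewrite VE big_ord_recl addn0 bin0 expr0 !mul1r subn0 mulrDr.
  rewrite [X in _ + X](_ : _ = 0) ?addr0 // mulr_sumr big1 // => i _.
  have /dvdnP[c ->] : (p %| 'C(p.-1 + lift ord0 i, lift ord0 i))%N.
    have ltiN := ltn_ord i; rewrite /= /bump add1n addnS -addSn prednK ?prime_gt0 //.
    rewrite -(@Gauss_dvdr _ i.+1) ?mul_bin_left ?addnK ?dvdn_mulr //.
    by rewrite prime_coprime // gtnNdvd //; lia.
  by rewrite natrM !mulrA [p%:R * _]mulrC -(mulrA c%:R) ppP0 mulr0 !mul0r.
have TE : \sum_(i < N.+1)
    'C(N + p, i)%:R * (-3%:R) ^+ i * 'C(3 * p + 3 * N - i.*2, 3 * N - i)%:R =
    ((1 + 'X) ^+ (3 * p) * V)`_(3 * N).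
  rewrite mulr_sumr coef_sum; apply: eq_bigr => i _; have ltiN := ltn_ord i.
  rewrite natabX [in RHS]mulrnAr coefMn mulrCA -exprD.
  rewrite coef_monomM_exp1X ifF; last by lia.
  rewrite -[RHS]mulr_natl mulrA (_ : (_ - _)%N = (3 * p + (i + 3 * (N - i)))%N) //.
  by lia.
(* The polynomial a^i b^(N-i) has degree 3N - i, so only i = 0 reaches x^(3N). *)
have V3N : V`_(3 * N) = 1.
  rewrite coef_sum big_ord_recl natabX coefMn coef_monomM_exp1X.
  rewrite bin0 !subn0 mulr1n expr0 mul1r binn big1 ?addr0 // => i _.
  rewrite natabX coefMn coef_monomM_exp1X bin_small.
    by rewrite mulr0 if_same mul0rn.
  by have := ltn_ord i; rewrite /= /bump; lia.
have low0 : ((1 + 'X) ^+ (3 * p) * V)`_(N.-1) = 0.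
  (* Here p = 2(N - 1) + 3, so 3 dividing N - 1 would force 3 to divide p. *)
  have ndvd3N : ~~ (3 %| N.-1)%N by apply: contra ndvd3p => /dvdnP[c Ec]; lia.
  have Z := coef_exp1X3 R (N + p) N.-1; rewrite (negPf ndvd3N) in Z; rewrite -[RHS]Z.
  rewrite -abE [a + b]addrC [in RHS]exprDn -addSn big_split_ord /= coefD [X in _ = _ + X]coef_sum.
  rewrite [X in _ = _ + X]big1 ?addr0 => [|i _]; last first.
    by rewrite mulrC abX coefMn coef_monomM_exp1X ifT ?mul0rn //; lia.
  rewrite mulr_sumr; congr (polyseq _)`_ _; apply: eq_bigr => i _; have ltiN := ltn_ord i.
  rewrite natabX mulrnAr mulrCA -exprD [b ^+ _ * _]mulrC abX.
  by congr ((_ * _ ^+ _) *+ _); lia.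
pose U := p%:R * q * K.
(* Cube 1 + x^p + pq: terms with (pq)^2 vanish, and pqV = pqK = U by [pV]. *)
have expand : (1 + 'X) ^+ (3 * p) * V =
    V + (V * 'X^p) *+ 3 + (V *+ 3 + V * 'X^p) * 'X^(2 * p)
    + (U *+ 3 + (U * 'X^p) *+ 6 + (U *+ 3) * 'X^(2 * p)).
  rewrite mulnC exprM qE [(2 * p)%N]mulnC exprM /U.
  move: (p%:R) ppP0 pV => P PP0 pV; set Y := 'X^p.
  rewrite [LHS](_ : _ = (1 + Y) ^+ 3 * V + 3%:R * (1 + Y) ^+ 2 * q * (P * V) +
    (P * P) * (3%:R * (1 + Y) * q ^+ 2 + P * q ^+ 3) * V); last by ring.
  by rewrite pV PP0; ring.
have lowE : V`_(N.-1) + U`_(N.-1) *+ 3 = 0.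
  have [ltNp ltN2p] : (N.-1 < p)%N /\ (N.-1 < 2 * p)%N by split; lia.
  rewrite -[RHS]low0 expand !(coefD, coefMn, coefMXn) ltNp ltN2p.
  by ring.
(* Since 3N - p = N - 1 and 3N < 2p, the factor x^p brings back the coefficients at x^(N-1), which
   [lowE] relates. *)
have highE : ((1 + 'X) ^+ (3 * p) * V)`_(3 * N) =
   1 + V`_(N.-1) *+ 3 + (U`_(3 * N) *+ 3 + U`_(N.-1) *+ 6).
  rewrite expand !(coefD, coefMn, coefMXn) V3N.
  have [-> -> ->] : [/\ (3 * N < p)%N = false, (3 * N < 2 * p)%N &
    (3 * N - p = N.-1)%N] by split; lia.
  by ring.
have pqE i : (p%:R * q)`_i = if (0 < i < p)%N then 'C(p, i)%:R else 0.
  have -> : p%:R * q = (1 + 'X) ^+ p - 1 - 'X^p by rewrite qE; ring.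
  rewrite !coefB coef_exp1X coef1 coefXn.
  have [-> | i_gt0] := posnP i; first by rewrite bin0 ltn_eqF ?prime_gt0 ?subr0 ?subrr.
  case: (ltngtP i p) => [_ | gtip | ->]; rewrite ?subr0 ?gtn_eqF ?subr0 //.
    by rewrite bin_small.
  by rewrite binn subrr.
have UE n : U`_n = \sum_(l < N.+1)
    'C(N, l)%:R * (if (n < 3 * l)%N then 0 else (p%:R * q)`_(n - 3 * l)).
  exact: coefM_exp1X3.
rewrite TE highE.
rewrite [LHS](_ : _ = 1 + (V`_N.-1 + U`_N.-1 *+ 3) *+ 3 + (U`_(3 * N) - U`_N.-1) *+ 3);
  last by ring.
(* Vandermonde writes C(N+p, N) as the sum of C(N, l) C(p, N-l). The term l = N is the 1 coming from
   V; the others match those of U one by one, with m = N - l. *)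
rewrite lowE mul0rn addr0 !UE -sumrB -binomial.Vandermonde big_ord_recr /= natr_sum.
rewrite [RHS]big_ord_recr /= !subnn ltnn binn bin0 [RHS]addrC; congr (_ + _).
rewrite !pqE /= ifT; last by lia.
rewrite mulr0 subrr addr0 -sumrMnl; apply: eq_bigr => l _; have ltlN := ltn_ord l.
rewrite -mulrBr -mulrnAr natrM; congr (_ * _).
rewrite (three_bin_prime _ _ _ (N - l)%N p_pr p_gt3 pE pp0 unitR); last by lia.
rewrite -mulr_natl; congr (_ * _).
have -> : (N.-1 < 3 * l)%N = (3 * (N - l) < p)%N by lia.
have -> : (3 * N < 3 * l)%N = false by lia.
rewrite -mulnBr; case: ltnP => [lt3p | le3p].
  by rewrite subr0 pqE ifT //; lia.
have neq3p : (3 * (N - l))%N != p by apply: contra ndvd3p => /eqP <-; rewrite dvdn_mulr.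
rewrite !pqE ifF ?ifT ?sub0r; try lia.
by congr (- 'C(_, _)%:R); lia.
Qed.

(** * The summands as polynomial values at -1/2 *)

Lemma fact_double (n : nat) :
  ((2 * n)`! = 2 ^ n * n`! * \prod_(j < n) (2 * j + 1))%N.
Proof.
elim: n => [|n IHn]; first by rewrite big_ord0.
rewrite big_ord_recr /= mulnS !factS IHn expnS; ring.
Qed.

Lemma central_bin_odd_prod (k : nat) :
  (k`! * 'C(2 * k, k) = 2 ^ k * \prod_(j < k) (2 * j + 1))%N.
Proof.
apply/eqP; rewrite -(eqn_pmul2l (fact_gt0 k)); apply/eqP.
have /bin_fact : (k <= 2 * k)%N by lia.
rewrite (_ : (2 * k - k = k)%N) ?fact_double => [E|]; last by lia.
by rewrite mulnA mulnC E; ring.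
Qed.

(** With k = m + 1, split (4k)! and (2k)! into powers of 2, factorials and odd products. The odd
    factors up to 2k+1 cancel, leaving 2k+3, ..., 4k-1. *)
Lemma bin_odd_prod (m : nat) :
  (m`! * 'C(4 * m.+1, 2 * m.+1 + 1) =
   2 ^ m.+2 * \prod_(j < m) (2 * (m.+2 + j) + 1))%N.
Proof.
have le : (2 * m.+1 + 1 <= 4 * m.+1)%N by lia.
have := bin_fact le; set B := 'C(_, _).
rewrite (_ : (4 * m.+1 - (2 * m.+1 + 1) = 2 * m + 1)%N); last by lia.
rewrite (_ : (4 * m.+1 = 2 * (m.+2 + m))%N) ?fact_double; last by lia.
rewrite big_split_ord big_ord_recr /=; set P := (\prod_(j < m) _)%N => BE.
have oddE := fact_double m.+1; set Q := (\prod_(j < m.+1) _)%N in BE oddE.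
have facE : ((2 * m.+1)`! = (2 * m.+1) * (2 * m + 1)`!)%N.
  by rewrite addn1 mulnS add2n factS.
have Q_gt0 : (0 < Q)%N by apply/prodn_gt0 => j; rewrite addn1.
have pos : (0 < (2 * m.+1 + 1) * (2 * m.+1)`! * Q * (2 ^ m.+1 * m.+1))%N.
  by rewrite !muln_gt0 fact_gt0 Q_gt0 expn_gt0 addn1.
apply/eqP; rewrite -(eqn_pmul2l pos); apply/eqP.
rewrite [LHS](_ : _ = B * ((2 * m.+1 + 1) * (2 * m.+1)`! *
    (2 ^ m.+1 * m.+1`! * Q)))%N; last by rewrite factS; ring.
rewrite -oddE facE.
rewrite [LHS](_ : _ = B * ((2 * m.+1 + 1)`! * (2 * m + 1)`!) * (2 * m.+1))%N;
  last by rewrite [(2 * m.+1 + 1)%N]addn1 factS facE; ring.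
rewrite BE -facE (_ : (m.+2 + m = 2 * m.+1)%N); last by lia.
rewrite (_ : (2 ^ (2 * m.+1) = 2 ^ m.+1 * 2 ^ m.+1)%N); last by rewrite -expnD; congr expn; lia.
by rewrite (expnS 2 m.+1); ring.
Qed.

(* F is a product of linear factors, so F (N + p t) is affine in t modulo p^2;
   the three values correspond to t = -1/2, 0 and 1. *)
Lemma taylor_half (R : comUnitRingType) (p N k : nat) (h : R) :
  p = N.*2.+1 -> p%:R * p%:R = 0 :> R -> 2%:R * h = -1 ->
  let F (z : R) :=
    \prod_(j < k) (z - j%:R) * \prod_(j < k.-1) ((2 * k)%:R + z - j%:R) in
  2%:R * F h = 3%:R * F N%:R - F (N + p)%:R.
Proof.
move=> pE pp0 hE F.
pose s := [seq N%:R - (val j)%:R | j <- index_enum 'I_k] ++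
          [seq (2 * k)%:R + N%:R - (val j)%:R : R | j <- index_enum 'I_k.-1].
have [D FD] := prod_shift R p%:R s pp0.
have FE t : F (N%:R + p%:R * t) = \prod_(u <- s) (u + p%:R * t).
  rewrite /F big_cat !big_map /=.
  by congr (_ * _); apply: eq_bigr => j _; ring.
(* From 2h = -1, p h = 2N h + h = h - N. *)
have -> : h = N%:R + p%:R * h.
  by rewrite pE -addn1 natrD -mul2n natrM mulrDl mulrAC hE; ring.
have -> : (N + p)%:R = N%:R + p%:R * 1 :> R by rewrite natrD mulr1.
have FN : F N%:R = \prod_(u <- s) u.
  by have := FE 0; rewrite mulr0 addr0 => ->; apply: eq_bigr => u _; rewrite addr0.
rewrite !FE !FD FN mulr1.
rewrite [LHS](_ : _ = 2%:R * \prod_(u <- s) u + p%:R * D * (2%:R * h)); last by ring.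
by rewrite hE; ring.
Qed.

(** After multiplication by k! (k-1)!, both binomials become products of odd numbers, that is,
    powers of 2 times falling factorials at h = -1/2. The powers collect to 2^(3k) (-2)^k =
    (-16)^k. *)
Lemma term_taylor (R : comUnitRingType) (p N k : nat) :
  (2 < p)%N -> p = N.*2.+1 -> p%:R * p%:R = 0 :> R ->
  (forall j, (0 < j < p)%N -> j%:R \is a @GRing.unit R) -> (0 < k < p)%N ->
  2%:R * ('C(4 * k, 2 * k + 1)%:R * 'C(2 * k, k)%:R) =
  (- 16%:R) ^+ k *
    (3%:R * ('C(N, k)%:R * 'C(2 * k + N, k.-1)%:R) -
     'C(N + p, k)%:R * 'C(2 * k + (N + p), k.-1)%:R) :> R.
Proof.
move=> p_gt2 pE pp0 unitR k_bnd.
have u2 : 2%:R \is a @GRing.unit R by apply: unitR.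
have ufact j : (j < p)%N -> j`!%:R \is a @GRing.unit R.
  elim: j => [|j IHj] ltjp; first by rewrite fact0 unitr1.
  by rewrite factS natrM unitrM unitR ?IHj // ltnW.
pose h : R := - 2%:R^-1.
have hE : 2%:R * h = -1 by rewrite /h mulrN divrr.
have := taylor_half R p N k h pE pp0 hE.
set F := (fun z : R => _) => /= TF.
have FE n : F n%:R = k`!%:R * k.-1`!%:R * ('C(n, k)%:R * 'C(2 * k + n, k.-1)%:R).
  by rewrite /F -natrD -!ffact_natr -!bin_ffact !natrM; ring.
have u : k`!%:R * k.-1`!%:R \is a @GRing.unit R.
  by rewrite unitrM !ufact //; lia.
apply: (mulrI u).
rewrite [RHS](_ : _ = (- 16%:R) ^+ k * (3%:R * F N%:R - F (N + p)%:R));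
  last by rewrite !FE; ring.
rewrite -TF mulrCA [RHS]mulrCA; congr (_ * _).
have [m kE] : exists m, k = m.+1 by exists k.-1; lia.
have oddk : (-2%:R) ^+ k * \prod_(j < k) (h - j%:R) = (\prod_(j < k) (2 * j + 1))%:R.
  rewrite -[k in _ ^+ k]card_ord -prodr_const -big_split natr_prod.
  apply: eq_bigr => j _ /=; rewrite natrD natrM.
  by rewrite mulNr mulrBr hE; ring.
have oddm : 2%:R ^+ m * \prod_(j < m) ((2 * k)%:R + h - j%:R) =
    (\prod_(j < m) (2 * (m.+2 + j) + 1))%:R.
  (* The falling product meets the odd numbers in decreasing order: 2(2k + h - j) = 4k - 1 - 2j. *)
  rewrite [in RHS](reindex_inj rev_ord_inj) natr_prod.
  rewrite -[m in _ ^+ m]card_ord -prodr_const -big_split.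
  apply: eq_bigr => j _ /=; have ltjm := ltn_ord j.
  rewrite mulrBr mulrDr hE.
  rewrite (_ : (2 * (m.+2 + (m - j.+1)) + 1 = 4 * k - 1 - 2 * j)%N); last by lia.
  by rewrite !natrB ?natrM; [ring | lia..].
have E2 : k`!%:R * 'C(2 * k, k)%:R =
    2%:R ^+ k * ((-2%:R) ^+ k * \prod_(j < k) (h - j%:R)).
  by rewrite oddk -natrM central_bin_odd_prod natrM natrX.
have E1 : k.-1`!%:R * 'C(4 * k, 2 * k + 1)%:R =
    2%:R ^+ k.+1 * (2%:R ^+ m * \prod_(j < m) ((2 * k)%:R + h - j%:R)).
  by rewrite oddm kE -natrM bin_odd_prod natrM natrX.
rewrite [LHS](_ : _ = (k.-1`!%:R * 'C(4 * k, 2 * k + 1)%:R) *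
   (k`!%:R * 'C(2 * k, k)%:R)); last by ring.
have m1E : k.-1 = m by rewrite kE.
rewrite E1 E2 /F m1E (_ : - 16%:R = 2%:R * 2%:R * 2%:R * (- 2%:R)); last by ring.
have e2 : 2%:R ^+ k = 2%:R * 2%:R ^+ m :> R by rewrite kE exprS.
rewrite !exprMn {4}e2 exprS; ring.
Qed.

(** * Vanishing of the sum modulo p^2 *)

(** The factor 48^(p-1) clears all denominators. *)
Lemma weighted_sum_bin_eq0 (R : comUnitRingType) (p N : nat) :
  prime p -> (3 < p)%N -> p = N.*2.+1 -> p%:R * p%:R = 0 :> R ->
  (forall j, (0 < j < p)%N -> j%:R \is a @GRing.unit R) ->
  \sum_(1 <= k < p)
    'C(4 * k, 2 * k + 1)%:R * 'C(2 * k, k)%:R * 48%:R ^+ (p.-1 - k) = 0 :> R.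
Proof.
move=> p_pr p_gt3 pE pp0 unitR.
have u2 : 2%:R \is a @GRing.unit R by apply: unitR; lia.
have u3 : -3%:R \is a @GRing.unit R by rewrite unitrN; apply: unitR; lia.
have ndvd3p : ~~ (3 %| p)%N by rewrite dvdn_prime2 // ltn_eqF.
pose G M k : R := 'C(M, k)%:R * 'C(2 * k + M, k.-1)%:R * (- 3%:R) ^+ (M - k).
have GN : \sum_(1 <= k < p) G N k = 0.
  rewrite (big_cat_nat (n := N.+1)) //=; try lia.
  rewrite sum_bin_shift; last by lia.
  rewrite coef_exp1X3 ifF; last first.
    by apply: contraNF ndvd3p => /dvdnP[c Ec]; lia.
  rewrite big_nat big1 ?addr0 // => k k_bnd.
  by rewrite /G bin_small ?mul0r //; lia.
(* The complete sum and its tail k >= p both equal C(N+p, N), the former because N + p - 1 = 3N; so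
   the part below p is 0. *)
have GNp : \sum_(1 <= k < p) G (N + p)%N k = 0.
  apply/eqP; rewrite -subr_eq0 subr0 -(inj_eq (addIr 'C(N + p, N)%:R)) add0r.
  rewrite -{1}(sum_bin_tail R p N p_pr p_gt3 pE pp0 unitR).
  have coefE : ((1 + 'X^3) ^+ (N + p) : {poly R})`_(N + p).-1 = 'C(N + p, N)%:R.
    rewrite coef_exp1X3 (_ : (N + p).-1 = N * 3)%N; last by lia.
    by rewrite dvdn_mull // mulnK.
  rewrite -[X in _ == X]coefE -sum_bin_shift; last by lia.
  rewrite [X in _ == X](big_cat_nat (n := p)) /=; try lia.
  apply/eqP; congr (_ + _).
  have rev (F : nat -> R) :
    \sum_(p <= k < (N + p).+1) F k = \sum_(i < N.+1) F (N + p - i)%N.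
    rewrite -addSn -{1}[p]add0n big_addn addnK big_nat_rev big_mkord.
    by apply: eq_bigr => i _; congr F; have := ltn_ord i; lia.
  rewrite rev; apply: eq_bigr => i _; have ltiN := ltn_ord i.
  rewrite bin_sub; last by lia.
  rewrite mulrAC subKn; last by lia.
  congr (_ * _ * _); congr ('C(_, _)%:R); lia.
(* The 2 is that of [term_taylor]; (-3)^(N+1) raises (-3)^(p-1-k) to the (-3)^(N+p-k) of
   [G (N + p)]. *)
have u23 : 2%:R * (- 3%:R) ^+ N.+1 \is a @GRing.unit R by rewrite unitrM u2 unitrX.
apply: (mulrI u23); rewrite mulr0 mulr_sumr.
rewrite (eq_big_nat _ _ (F2 := fun k => 16%:R ^+ p.-1 *
   (3%:R * ((- 3%:R) ^+ p * G N k) - G (N + p)%N k))).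
  by rewrite -mulr_sumr sumrB -!mulr_sumr GN GNp !mulr0 subr0 mulr0.
move=> k k_bnd; rewrite mulrACA (term_taylor R p N k) //; last by lia.
have -> : 16%:R ^+ p.-1 = (- 16%:R) ^+ p.-1 :> R.
  by rewrite pE /= -mul2n !exprM sqrrN.
rewrite -{2}[p.-1](@subnK k); last by lia.
rewrite exprD (_ : 48%:R = - 16%:R * - 3%:R); last by ring.
rewrite exprMn.
have -> : G (N + p)%N k = 'C(N + p, k)%:R * 'C(2 * k + (N + p), k.-1)%:R *
    ((- 3%:R) ^+ N.+1 * (- 3%:R) ^+ (p.-1 - k)).
  by rewrite -exprD /G; congr (_ * _ ^+ _); lia.
have -> : (- 3%:R) ^+ p * G N k = 'C(N, k)%:R * 'C(2 * k + N, k.-1)%:R *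
    ((- 3%:R) ^+ N.+1 * (- 3%:R) ^+ (p.-1 - k)).
  rewrite /G; case: (leqP k N) => [lekN | ltNk]; last by rewrite bin_small // !mul0r mulr0.
  rewrite mulrCA -!exprD; congr (_ * _ ^+ _); lia.
ring.
Qed.

Lemma dvdn_sum_bin (p : nat) : prime p -> (3 < p)%N ->
  (p ^ 2 %|
   \sum_(1 <= k < p) 'C(4 * k, 2 * k + 1) * 'C(2 * k, k) * 48 ^ (p.-1 - k))%N.
Proof.
move=> p_pr p_gt3.
(* The type ['Z_n] is the ring of integers modulo n only when n > 1. *)
have p2_gt1 : (1 < p ^ 2)%N by rewrite -(exp1n 2) ltn_sqr; lia.
have p_odd : odd p by case/even_prime: p_pr => // pE; rewrite pE in p_gt3.
have pE : p = p./2.*2.+1 by rewrite -[LHS]odd_double_half p_odd.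
have pp0 : p%:R * p%:R = 0 :> 'Z_(p ^ 2) by rewrite -natrM mulnn pchar_Zp.
have unitR j : (0 < j < p)%N -> j%:R \is a @GRing.unit 'Z_(p ^ 2).
  by case/andP=> *; rewrite unitZpE // coprimeXl // prime_coprime // gtnNdvd.
set S := (\sum_(1 <= k < p) _)%N.
have S0 : S%:R = 0 :> 'Z_(p ^ 2).
  rewrite natr_sum -[RHS](weighted_sum_bin_eq0 _ _ _ p_pr p_gt3 pE pp0 unitR).
  by apply: eq_bigr => k _; rewrite !natrM natrX.
by rewrite /dvdn -val_Zp_nat // S0.
Qed.

(** * Return to p-integral rationals *)

Lemma natr_div_Zloc (p a b : nat) : coprime p b -> (a%:R / b%:R : rat) \in Zloc p.
Proof.
rewrite inE !pmulrn.
rewrite -[b in coprime p b]/`|b%:Z|%N.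
case: (divqP a b) => [_|k x _]; first by rewrite coprimen1.
by rewrite abszM coprimeMr => /andP[].
Qed.

Theorem theorem1p1 (p : nat) (p_prime : prime p) (p_gt3 : (3 < p)%N) :
  eqmod_Zloc p (p ^ 2)
    (\sum_(0 <= k < p)
       ('C(4 * k, 2 * k + 1)%:R * 'C(2 * k, k)%:R) / 48%:R ^+ k)
    0.
Proof.
have /dvdnP[c Ec] := dvdn_sum_bin p p_prime p_gt3.
have cop48 : coprime p (48 ^ p.-1).
  rewrite coprimeXr // (_ : 48 = 2 ^ 4 * 3)%N // coprimeMr coprimeXr //;
  by rewrite prime_coprime // dvdn_prime2 //; apply/eqP; lia.
have -> : \sum_(0 <= k < p)
    ('C(4 * k, 2 * k + 1)%:R * 'C(2 * k, k)%:R) / 48%:R ^+ k =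
    (p ^ 2)%:R * (c%:R / (48 ^ p.-1)%:R) :> rat.
  (* The term k = 0 is zero because C(0, 1) = 0. *)
  rewrite big_ltn ?prime_gt0 // bin_small // mulr0n !mul0r add0r.
  rewrite mulrA -natrM [(_ * c)%N]mulnC -Ec natr_sum mulr_suml.
  apply: eq_big_nat => k k_bnd; rewrite !natrM -[RHS]mulrA; congr (_ * _).
  have lekp : (k <= p.-1)%N by lia.
  rewrite !natrX -{2}(subnK lekp) exprD invfM mulrA divff ?mul1r //.
  by rewrite expf_neq0.
split; last by exists (c%:R / (48 ^ p.-1)%:R); rewrite ?natr_div_Zloc // subr0.
  by rewrite mulrA -natrM natr_div_Zloc.
by rewrite inE coprimen1.
Qed.
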